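(* Let $\mathcal{I}$ be a small full subcategory of the category $\mathbf{Top}$ of topological spaces and continuous maps. Then the category $\mathbf{Top}_{\mathcal{I}}$ of $\mathcal{I}$-generated topological spaces is locally presentable.
   Context: For a full subcategory $\mathcal{I}$ of $\mathbf{Top}$, a topological space $X$ is $\mathcal{I}$-generated if a subset $S\subseteq X$ is open whenever $f^{-1}(S)$ is open in $Z$ for every continuous map $f:Z\to X$ with $Z\in\mathcal{I}$. $\mathbf{Top}_{\mathcal{I}}$ is the full subcategory of $\mathbf{Top}$ consisting of the $\mathcal{I}$-generated spaces. A category is locally presentable if, for some regular cardinal $\lambda$, it is cocomplete and has a set $\mathcal{A}$ of $\lambda$-presentable objects (objects $K$ for which $\hom(K,-)$ preserves $\lambda$-filtered colimits) such that every object is a $\lambda$-directed colimit of objects from $\mathcal{A}$. *)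

(* Defs.v *)
From mathcomp Require Import all_boot all_order.
From mathcomp Require Import boolp classical_sets functions cardinality topology.

Set Implicit Arguments.
Unset Strict Implicit.
Unset Printing Implicit Defensive.

Local Open Scope classical_set_scope.
Local Open Scope card_scope.

(* A "set" in the sense of category theory is a type in the very universe that
   contains the carriers of all objects of topologicalType.  In particular
   topologicalType itself is not a small type. *)
Notation smallType := Type@{Topological.axioms_.u0}.

(* Locally small categories on a type of objects.  A category is small when its
   type of objects is a small type as well. *)
Record category (Ob : Type) := Category {
  hom : Ob -> Ob -> smallType;
  idm : forall X, hom X X;
  comp : forall X Y Z, hom Y Z -> hom X Y -> hom X Z;
  comp_idl : forall X Y (f : hom X Y), comp (idm Y) f = f;
  comp_idr : forall X Y (f : hom X Y), comp f (idm X) = f;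
  compA : forall W X Y Z (h : hom Y Z) (g : hom X Y) (f : hom W X),
    comp h (comp g f) = comp (comp h g) f
}.

Record functor (Ob Ob' : Type) (C : category Ob) (D : category Ob') := Functor {
  fob :> Ob -> Ob';
  fmap : forall X Y, hom C X Y -> hom D (fob X) (fob Y);
  fmap_id : forall X, fmap (idm C X) = idm D (fob X);
  fmap_comp : forall X Y Z (g : hom C Y Z) (f : hom C X Y),
    fmap (comp g f) = comp (fmap g) (fmap f)
}.

Lemma functor_comp_id (Ob1 Ob2 Ob3 : Type) (C : category Ob1)
    (D : category Ob2) (E : category Ob3) (G : functor D E) (F : functor C D) X :
  fmap G (fmap F (idm C X)) = idm E (G (F X)).
Proof. by rewrite !fmap_id. Qed.

Lemma functor_comp_comp (Ob1 Ob2 Ob3 : Type) (C : category Ob1)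
    (D : category Ob2) (E : category Ob3) (G : functor D E) (F : functor C D)
    X Y Z (g : hom C Y Z) (f : hom C X Y) :
  fmap G (fmap F (comp g f)) = comp (fmap G (fmap F g)) (fmap G (fmap F f)).
Proof. by rewrite !fmap_comp. Qed.

Definition functor_comp (Ob1 Ob2 Ob3 : Type) (C : category Ob1)
    (D : category Ob2) (E : category Ob3) (G : functor D E) (F : functor C D) :
    functor C E :=
  Functor (fun X => functor_comp_id G F X)
    (fun X Y Z g f => functor_comp_comp G F g f).

Definition set_category : category smallType :=
  @Category smallType (fun A B => A -> B) (fun A => @id A)
    (fun _ _ _ g f => fun x => g (f x))
    (fun _ _ _ => erefl) (fun _ _ _ => erefl) (fun _ _ _ _ _ _ _ => erefl).

Lemma hom_functor_id (Ob : Type) (C : category Ob) (K X : Ob) :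
  (fun g : hom C K X => comp (idm C X) g) = idm set_category (hom C K X).
Proof. by apply: funext => g; rewrite comp_idl. Qed.

Lemma hom_functor_comp (Ob : Type) (C : category Ob) (K X Y Z : Ob)
    (g : hom C Y Z) (f : hom C X Y) :
  (fun h : hom C K X => comp (comp g f) h) =
  comp (c := set_category) (fun h : hom C K Y => comp g h)
    (fun h : hom C K X => comp f h).
Proof. by apply: funext => h; rewrite /= compA. Qed.

Definition hom_functor (Ob : Type) (C : category Ob) (K : Ob) :
    functor C set_category :=
  @Functor _ _ C set_category (hom C K) (fun X Y f g => comp f g)
    (hom_functor_id C K) (fun X Y Z g f => hom_functor_comp K g f).

Definition full_subcategory (Ob : Type) (C : category Ob) (P : Ob -> Prop) :
    category {X : Ob | P X} :=
  @Category {X : Ob | P X} (fun X Y => hom C (sval X) (sval Y))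
    (fun X => idm C (sval X)) (fun _ _ _ g f => comp g f)
    (fun _ _ f => comp_idl f) (fun _ _ f => comp_idr f)
    (fun _ _ _ _ h g f => compA h g f).

Section Colimits.
Variables (Ob Ob' : Type) (C : category Ob) (D : category Ob').

Record cocone (F : functor D C) (c : Ob) := Cocone {
  leg : forall d : Ob', hom C (F d) c;
  leg_natural : forall (d d' : Ob') (f : hom D d d'),
    comp (leg d') (fmap F f) = leg d
}.

Definition is_colimit (F : functor D C) (c : Ob) (k : cocone F c) : Prop :=
  forall (c' : Ob) (k' : cocone F c'),
    exists! h : hom C c c', forall d, comp h (leg k d) = leg k' d.

End Colimits.

Lemma map_cocone_natural (Ob1 Ob2 Ob3 : Type) (C : category Ob1)
    (D : category Ob2) (E : category Ob3) (F : functor D C) (G : functor C E)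
    (c : Ob1) (k : cocone F c) (d d' : Ob2) (f : hom D d d') :
  comp (fmap G (leg k d')) (fmap (functor_comp G F) f) = fmap G (leg k d).
Proof. by rewrite /= -fmap_comp leg_natural. Qed.

Definition map_cocone (Ob1 Ob2 Ob3 : Type) (C : category Ob1)
    (D : category Ob2) (E : category Ob3) (F : functor D C) (G : functor C E)
    (c : Ob1) (k : cocone F c) : cocone (functor_comp G F) (G c) :=
  Cocone (map_cocone_natural G k).

Definition preserves_colimits_of (Ob1 Ob2 Ob3 : Type) (C : category Ob1)
    (D : category Ob2) (E : category Ob3) (F : functor D C) (G : functor C E) :
    Prop :=
  forall (c : Ob1) (k : cocone F c), is_colimit k -> is_colimit (map_cocone G k).

Definition cocomplete (Ob : Type) (C : category Ob) : Prop :=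
  forall (J : smallType) (D : category J) (F : functor D C),
    exists (c : Ob) (k : cocone F c), is_colimit k.

(* Cardinals are represented by small types, up to bijection. *)
Definition card_lt (T U : Type) (A : set T) (B : set U) : Prop := ~ (B #<= A).

(* An infinite cardinal that is not a sum of fewer than itself many cardinals
   all smaller than itself. *)
Definition regular_cardinal (L : smallType) : Prop :=
  infinite_set [set: L] /\
  forall (J : smallType) (A : J -> smallType),
    card_lt [set: J] [set: L] ->
    (forall j, card_lt [set: A j] [set: L]) ->
    card_lt [set: {j : J & A j}] [set: L].

Definition arrow (Ob : Type) (C : category Ob) : Type :=
  {XY : Ob * Ob & hom C XY.1 XY.2}.

Definition filtered (L J : smallType) (D : category J) : Prop :=
  forall (E : smallType) (S : category E) (F : functor S D),
    card_lt [set: arrow S] [set: L] -> exists d : J, inhabited (cocone F d).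

Definition presentable (L : smallType) (Ob : Type) (C : category Ob) (K : Ob) :
    Prop :=
  forall (J : smallType) (D : category J), filtered L D ->
    forall F : functor D C, preserves_colimits_of F (hom_functor C K).

Definition is_poset (P : smallType) (le : rel P) : Prop :=
  [/\ reflexive le, antisymmetric le & transitive le].

Lemma poset_refl (P : smallType) (le : rel P) : is_poset le -> forall x, le x x.
Proof. by case. Qed.

Lemma poset_trans (P : smallType) (le : rel P) : is_poset le ->
  forall x y z, le y z -> le x y -> le x z.
Proof. by case=> _ _ le_trans x y z yz xy; exact: le_trans xy yz. Qed.

Definition poset_category (P : smallType) (le : rel P) (po : is_poset le) :
    category P :=
  @Category P (fun x y => le x y) (poset_refl po) (poset_trans po)
    (fun _ _ _ => bool_irrelevance _ _) (fun _ _ _ => bool_irrelevance _ _)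
    (fun _ _ _ _ _ _ _ => bool_irrelevance _ _).

Definition directed (L P : smallType) (le : rel P) : Prop :=
  forall A : set P, card_lt A [set: L] ->
    exists u : P, forall a, A a -> le a u.

Definition directed_colimit_from (L : smallType) (Ob : Type) (C : category Ob)
    (A : Ob -> Prop) (X : Ob) : Prop :=
  exists (P : smallType) (le : rel P) (po : is_poset le)
      (F : functor (poset_category po) C) (k : cocone F X),
    [/\ directed L le, forall p, A (F p) & is_colimit k].

(* A class of objects that is a set: the range of a small family. *)
Definition small_class (Ob : Type) (A : Ob -> Prop) : Prop :=
  exists (J : smallType) (Z : J -> Ob), forall X, A X <-> exists j, Z j = X.

Definition locally_presentable (Ob : Type) (C : category Ob) : Prop :=
  exists L : smallType,
    [/\ regular_cardinal L,
        cocomplete C &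
        exists A : Ob -> Prop,
          [/\ small_class A,
              forall K, A K -> presentable L C K &
              forall X, directed_colimit_from L C A X]].

Definition cts_comp (X Y Z : topologicalType) (g : continuousType Y Z)
  (f : continuousType X Y) : continuousType X Z := g \o f.

Lemma cts_comp_idl (X Y : topologicalType) (f : continuousType X Y) :
  cts_comp idfun f = f.
Proof. exact/continuousEP. Qed.

Lemma cts_comp_idr (X Y : topologicalType) (f : continuousType X Y) :
  cts_comp f idfun = f.
Proof. exact/continuousEP. Qed.

Lemma cts_compA (W X Y Z : topologicalType) (h : continuousType Y Z)
    (g : continuousType X Y) (f : continuousType W X) :
  cts_comp h (cts_comp g f) = cts_comp (cts_comp h g) f.
Proof. exact/continuousEP. Qed.

Definition Top : category topologicalType :=
  @Category topologicalType (fun X Y => continuousType X Y)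
    (fun X => @idfun X : continuousType X X) cts_comp
    cts_comp_idl cts_comp_idr cts_compA.

(* A full subcategory of Top is given by its class I of objects. *)
Definition generated (I : topologicalType -> Prop) (X : topologicalType) : Prop :=
  forall S : set X,
    (forall (Z : topologicalType) (f : Z -> X),
       I Z -> continuous f -> open (f @^-1` S)) ->
    open S.

Definition Top_generated (I : topologicalType -> Prop) :
    category {X : topologicalType | generated I X} :=
  full_subcategory Top (generated I).

(* Main.v *)
From HB Require Import structures.
From mathcomp Require Import all_boot boolp classical_sets functions cardinality.
From mathcomp Require Import wochoice topology.
Require Import Defs.

(** Let Z range over the spaces of I. Choose an infinite cardinal K with
    K * K <= K that is at least the number of these spaces and at least the size
    of each, with K ^ Z <= K, and let L be the successor of K, so that L is
    regular and smaller than L means at most K. The generated spaces of size at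
    most K serve as the generating set of L-presentable objects.

    Colimits of generated spaces are computed in topological spaces, because a
    final topology for maps out of generated spaces is generated
    ([generated_final], [Top_generated_cocomplete]).

    Every generated space X is the colimit of its pieces ([pieces_colimit]): at
    most K points together with at most K charts, that is continuous maps from
    the spaces Z, landing in them, with the final topology for these charts.
    Unions of K pieces are pieces, so the colimit is L-directed.

    The heart of the matter is that small generated spaces are presentable
    ([small_presentable]). The topology of an L-filtered colimit of generated
    spaces is final for all the charts coming from the stages, and one must see
    that a map g : Z -> X continuous for this topology is already continuous for
    the final topology of at most K of these charts ([few_charts]). A subset of X
    is closed when it is closed under the rules: if f is a chart, z is adherent
    to B in its domain, and f (B) is contained in the subset, then f z belongs to
    it. These rules have at most K premises each, so a point in the closure of a
    set is put there by at most K charts; and the continuity of g is a collection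
    of at most K statements that a point is in the closure of a set. Such a set
    of K charts, with the at most K coincidences between their points, is
    present at some stage of the diagram, where the lift of a continuous map is
    therefore continuous ([colimit_lift]). *)

Set Implicit Arguments.
Unset Strict Implicit.
Unset Printing Implicit Defensive.

Local Open Scope classical_set_scope.
Local Open Scope card_scope.

(** * Comparison of sizes by injections *)

Definition embeds (T U : Type) : Prop := exists f : T -> U, injective f.

Lemma embeds_trans (T U V : Type) : embeds T U -> embeds U V -> embeds T V.
Proof. by move=> [f fI] [g gI]; exists (g \o f); exact: inj_comp. Qed.

Lemma sval_inj (T : Type) (P : T -> Prop) : injective (@sval T P).
Proof. by move=> [x Px] [y Py] /= xy; exact: eq_exist. Qed.

Lemma embeds_sig (T : Type) (A : set T) : embeds {x | A x} T.
Proof. by exists sval; exact: sval_inj. Qed.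

Lemma embeds_of_surj (T U : Type) (f : T -> U) :
  (forall u, exists t, f t = u) -> embeds U T.
Proof.
move=> /choice[g gK]; exists g => u v guv; by rewrite -(gK u) guv gK.
Qed.

Lemma embeds_prod (T T' U U' : Type) :
  embeds T T' -> embeds U U' -> embeds (T * U) (T' * U').
Proof.
move=> [f fI] [g gI]; exists (fun p => (f p.1, g p.2)).
by move=> [x y] [x' y'] /= [/fI-> /gI->].
Qed.

Lemma embeds_sigT (T : Type) (U : T -> Type) (T' U' : Type) :
  embeds T T' -> (forall t, embeds (U t) U') -> embeds {t & U t} (T' * U').
Proof.
move=> [f fI] /(_ _)/cid-/all_sig[g gI].
exists (fun p => (f (projT1 p), g _ (projT2 p))).
move=> [x y] [x' y'] /= [/fI xx']; case: _ / xx' y' => y' /gI -> //.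
Qed.

Lemma embeds_postcomp (T U U' : Type) : embeds U U' -> embeds (T -> U) (T -> U').
Proof.
move=> [j jI]; exists (fun h => j \o h) => h h' hh'.
by apply: funext => t; apply: jI; exact: (congr1 (fun k => k t) hh').
Qed.

(** A function on T extends to T' by a constant outside the image of T. *)
Lemma embeds_precomp (T T' U : Type) (u0 : U) :
  embeds T T' -> embeds (T -> U) (T' -> U).
Proof.
move=> [i iI].
pose ext (h : T -> U) t' :=
  if pselect (exists t, i t = t') is left e then h (sval (cid e)) else u0.
have extE h t : ext h (i t) = h t.
  rewrite /ext; case: pselect => [e|[]]; last by exists t.
  by case: cid => s /= /iI ->.
exists ext => h h' hh'; apply: funext => t.
by rewrite -(extE h) hh' extE.
Qed.

Lemma embeds_curry (T U V : Type) : embeds (T -> U -> V) (T * U -> V).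
Proof.
exists (fun h p => h p.1 p.2) => h h' hh'.
by apply: funext => t; apply: funext => u; exact: (congr1 (fun k => k (t, u)) hh').
Qed.

Lemma embeds_pairing (T U V : Type) : embeds ((T -> U) * (T -> V)) (T -> U * V).
Proof.
exists (fun p t => (p.1 t, p.2 t)) => -[f g] [f' g'] /= e.
have e' t : (f t, g t) = (f' t, g' t) by exact: (congr1 (fun k => k t) e).
by congr pair; apply: funext => t; case: (e' t).
Qed.

Lemma embeds_card_leP (T U : Type) (B : set U) :
  [set: T] #<= B <-> embeds T {x | B x}.
Proof.
split=> [/card_leP[f]|[f fI]].
  exists (fun t => exist _ (val (f (SigSub (mem_set (I : setT t)))))
                  (set_mem (valP (f (SigSub (mem_set (I : setT t))))))).
  move=> x y /(congr1 sval)/= /val_inj.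
  by move/(inj (f:=f)); rewrite !in_setT => /(_ isT isT) [].
apply/card_leP/injfunPex => /=.
exists (fun t => SigSub (mem_set (svalP (f (val t))))) => //.
move=> x y _ _ /(congr1 val) /= e.
by apply: val_inj; apply: fI; apply: sval_inj.
Qed.

(** * Successor cardinals *)

(** The subsets of K are well-ordered. Those with at most K predecessors form
    an initial segment; were it of size at most K, the first subset outside it
    would have few predecessors too and belong to it, so the segment would be
    the whole power set, against Cantor. *)
Lemma hartogs (K : Type) : exists (L : Type) (lt : L -> L -> Prop),
  [/\ well_founded lt, (forall x y, x = y \/ lt x y \/ lt y x),
      (forall x, embeds {y | lt y x} K) & ~ embeds L K].
Proof.
have [R Rwo] := well_ordering_principle {classic (set K)}.
have minR (A : set (set K)) : A !=set0 ->
    exists2 z, A z & forall x, A x -> R z x.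
  move=> [a Aa]; have [|z [[zA zmin] _]] := Rwo (fun x => `[< A x >]).
    by exists a; exact/asboolP.
  exists z; first exact/asboolP.
  by move=> x Ax; apply: zmin; exact/asboolP.
have Rtot x y : R x y \/ R y x.
  have [|z [->|->] zmin] := minR (fun z => z = x \/ z = y).
  - by exists x; left.
  - by left; apply: zmin; right.
  - by right; apply: zmin; left.
have Ranti x y : R x y -> R y x -> x = y.
  move=> xy yx; have [|z [_ zuniq]] := Rwo (fun z => `[< z = x \/ z = y >]).
    by exists x; apply/asboolP; left.
  have Rxx u : R u u by case: (Rtot u u).
  rewrite -(zuniq x) ?(zuniq y) //; split; try by apply/asboolP; tauto.
    by move=> u /asboolP[|] ->.
  by move=> u /asboolP[|] ->.
pose lt (x y : set K) := R x y /\ x <> y.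
pose small (x : set K) := embeds {y | lt y x} K.
pose L := {x | small x}.
exists L, (fun x y => lt (sval x) (sval y)); split.
- move=> x; apply: contrapT => nax.
  pose ltL (x y : L) := lt (sval x) (sval y).
  pose B (u : set K) := exists2 v : L, sval v = u & ~ Acc ltL v.
  have [|z [w wz naw] zmin] := minR B; first by exists (sval x), x.
  apply: naw; constructor => y [yw yNw]; apply: contrapT => nay.
  by apply: yNw; apply: Ranti => //; rewrite wz; apply: zmin; exists y.
- move=> x y; case: (pselect (x = y)) => [|xy]; first by left.
  right; case: (Rtot (sval x) (sval y)) => [h|h]; [left|right]; split=> //.
    by move/sval_inj.
  by move/esym/sval_inj.
- move=> [x sx] /=; apply: embeds_trans sx.
  exists (fun y => exist (fun z => lt z x) (sval (sval y)) (svalP y)).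
  by move=> y y' [] /sval_inj /sval_inj.
- move=> LK; have [x nx] : exists x, ~ small x.
    apply: contrapT => /forallNP sm.
    have {}sm x : small x by apply: contrapT; exact: sm.
    have : embeds (set K) K.
      apply: embeds_trans (LK); exists (fun x => exist small x (sm x)).
      by move=> x y [].
    move=> [f fI]; pose D k := exists2 A, f A = k & ~ A k.
    have DD : ~ D (f D) by move=> h; case: (h) => A /fI ->; exact.
    by apply: (DD); exists D.
  have [|z nz zmin] := minR (fun x => ~ small x); first by exists x.
  apply: nz; apply: embeds_trans (LK).
  have sm (y : {y | lt y z}) : small (sval y).
    apply: contrapT => /zmin zy; case: (svalP y) => yz; apply.
    exact: Ranti.
  exists (fun y => exist small (sval y) (sm y)).
  by move=> y y' [] /sval_inj.
Qed.

(** Having size at most K and being of size strictly below L are the same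
    property of a set; all later size estimates are made with K. To compare J
    with L, elements of J are enumerated without repetition along L: either the
    enumeration never stops and embeds L into J, or it exhausts J within a
    proper initial segment of L, which has size at most K. *)
Lemma successor_cardinal (K : Type) : exists L : Type,
  forall J : Type, ~ embeds L J <-> embeds J K.
Proof.
have [L [lt [ltwf lttot ltK LK]]] := hartogs K.
exists L => J; split; last first.
  by move=> JK LJ; apply: LK; exact: embeds_trans LJ JK.
move=> LJ.
pose step x (rec : forall y, lt y x -> option J) : option J :=
  if pselect (exists j, forall y (yx : lt y x), rec y yx <> Some j) is left e
  then Some (sval (cid e)) else None.
pose g := Fix ltwf (fun=> option J) step.
have gE x : g x = step x (fun y _ => g y).
  apply: Fix_eq => y r r' rr'; congr (step y _).
  apply: functional_extensionality_dep => z.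
  by apply: functional_extensionality_dep => zy.
have [[x gx]|gS] := pselect (exists x, g x = None).
  apply: embeds_trans (ltK x).
  have : forall j, exists y : {y | lt y x}, g (sval y) = Some j.
    move=> j; apply: contrapT => h.
    move: gx; rewrite gE /step; case: pselect => // -[]; exists j => y yx gy.
    by apply: h; exists (exist _ y yx).
  move=> /choice[k kE]; exists k => i j kij.
  by have := kE i; rewrite kij kE => -[].
have {}gS x : exists j, g x = Some j.
  case E : (g x) => [j|]; first by exists j.
  by exfalso; apply: gS; exists x.
have [f fE] := choice gS.
have fN x y : lt x y -> f x <> f y.
  move=> xy e; move: (fE y); rewrite gE /step; case: pselect => // ex [].
  by case: cid => j /= /(_ x xy); rewrite fE e => + ej; rewrite ej.
exfalso; apply: LJ; exists f => x y fxy.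
by case: (lttot x y) => [//|[/fN|/fN]] //; rewrite fxy.
Qed.

(** A cardinal K = W ^ W with W * W <= W satisfies K * K <= K and K ^ W <= K,
    and W = T ^ nat has the required property for every T; it remains to take T
    large. *)
Lemma bounding_cardinal (J : Type) (Z : J -> Type) : exists K : Type,
  [/\ embeds (K * K) K, embeds nat K, embeds J K, forall j, embeds (Z j) K &
      forall j, embeds (Z j -> K) K].
Proof.
pose T := (bool + {j & option (Z j)})%type; pose W := nat -> T.
pose w0 : W := fun=> inl true.
have WW : embeds (W * W) W.
  (* Interleaving two sequences is injective. *)
  exists (fun p n => if odd n then p.2 n./2 else p.1 n./2).
  move=> [u v] [u' v'] /= e.
  have e' n : (if odd n then v n./2 else u n./2) =
              (if odd n then v' n./2 else u' n./2) by exact: (congr1 (fun k => k n) e).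
  congr pair; apply: funext => n.
    by have := e' n.*2; rewrite odd_double doubleK.
  by have := e' n.*2.+1; rewrite /= odd_double uphalf_double.
have TW : embeds T W by exists (fun t => fun=> t) => t t' /(congr1 (fun k => k 0)).
have ZW j : embeds (Z j) W.
  apply: embeds_trans (TW); exists (fun z => inr (existT _ j (Some z))) => z z' [].
  by apply: (@existT_inj2 {classic J} Z).
have WK : embeds W (W -> W).
  by exists (fun w => fun=> w) => w w' /(congr1 (fun k => k w0)).
exists (W -> W); split.
- apply: embeds_trans (embeds_pairing _ _ _) _; exact: embeds_postcomp.
- apply: embeds_trans (WK); exists (fun n m => inl (m == n)) => n n'.
  by move=> /(congr1 (fun k => k n)) []; rewrite eqxx => /esym/eqP.
- apply: embeds_trans (WK); apply: embeds_trans (TW).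
  by exists (fun j : J => inr (existT (fun j => option (Z j)) j None)) => j j' [].
- by move=> j; apply: embeds_trans (WK).
- move=> j; apply: embeds_trans (embeds_curry _ _ _) _.
  apply: embeds_precomp => //; apply: embeds_trans (WW); apply: embeds_prod => //.
  by exists id.
Qed.

Section SuccessorCardinal.
Variables (K L : Type).
Hypothesis L_succ : forall J : Type, ~ embeds L J <-> embeds J K.

Lemma card_lt_succ (T : Type) (A : set T) :
  card_lt A [set: L] <-> embeds {x | A x} K.
Proof. by rewrite -L_succ /card_lt embeds_card_leP. Qed.

Lemma card_lt_succT (T : Type) : card_lt [set: T] [set: L] <-> embeds T K.
Proof.
rewrite card_lt_succ; split; apply: embeds_trans; last exact: embeds_sig.
by exists (fun t => exist _ t I) => t t' [].
Qed.

Lemma succ_infinite : embeds nat K -> infinite_set [set: L].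
Proof.
move=> natK /finite_set_countable /embeds_card_leP Lnat.
have /L_succ : embeds K K by exists id.
apply; apply: embeds_trans (natK); apply: embeds_trans Lnat _; exact: embeds_sig.
Qed.

End SuccessorCardinal.

(** A successor cardinal is regular: a union of at most K sets of size at
    most K has size at most K * K. *)
Lemma succ_regular (K L : smallType) :
  (forall J : Type, ~ embeds L J <-> embeds J K) -> embeds nat K ->
  embeds (K * K) K -> regular_cardinal L.
Proof.
move=> L_succ natK KK; split; first exact: succ_infinite L_succ natK.
move=> J A /(card_lt_succT L_succ) JK AK; apply/(card_lt_succT L_succ).
by apply: embeds_trans KK; apply: embeds_sigT => // j; apply/(card_lt_succT L_succ).
Qed.

(** * Final topologies *)

(** Topologies on a fixed set: the topologies on subsets of K have to range
    over a small type. *)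
Record topology (T : Type) := Topology {
  is_open : set (set T);
  is_openT : is_open setT;
  is_openI : setI_closed is_open;
  is_open_bigU : forall (I : Type) (f : I -> set T),
    (forall i, is_open (f i)) -> is_open (\bigcup_i f i)
}.

(** A copy of T that remembers the topology, so that the instances declared on
    it do not depend on T alone. *)
Definition carrier (T : smallType) (t : topology T) : smallType := T.

Section Space.
Variables (T : smallType) (t : topology T).

HB.instance Definition _ := gen_eqMixin (carrier t).
HB.instance Definition _ := gen_choiceMixin (carrier t).
HB.instance Definition _ := isOpenTopological.Build (carrier t)
  (@is_openT _ t) (@is_openI _ t) (@is_open_bigU _ t).

Definition space_of : topologicalType := carrier t.

Lemma open_space_of (S : set space_of) : open S = is_open t S.
Proof. by []. Qed.

End Space.

Definition cts (X Y : topologicalType) (f : X -> Y) (fc : continuous f) :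
  continuousType X Y := mkcts fc.

Lemma ctsE (X Y : topologicalType) (f : X -> Y) (fc : continuous f) x :
  cts fc x = f x.
Proof. by []. Qed.

Section FinalTopology.
Variables (M : Type) (Z : M -> topologicalType).

Section Space.
Variables (T : smallType) (f : forall m, Z m -> T).
Arguments f : clear implicits.

Definition final_open : set (set T) := [set S | forall m, open (f m @^-1` S)].

Lemma final_openT : final_open setT.
Proof. by move=> m; exact: openT. Qed.

Lemma final_openI : setI_closed final_open.
Proof. by move=> A B Ao Bo m; rewrite preimage_setI; exact: openI. Qed.

Lemma final_open_bigU (I : Type) (A : I -> set T) :
  (forall i, final_open (A i)) -> final_open (\bigcup_i A i).
Proof. by move=> Ao m; rewrite preimage_bigcup; apply: bigcup_open => i _; exact: Ao. Qed.

Definition final : topology T :=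
  Topology final_openT final_openI final_open_bigU.

Lemma continuous_final_leg m : continuous (f m : Z m -> space_of final).
Proof. by apply/continuousP => A; exact. Qed.

Lemma continuous_from_final (Y : topologicalType) (h : space_of final -> Y) :
  (forall m, continuous (h \o f m : Z m -> Y)) -> continuous h.
Proof.
move=> hf; apply/continuousP => A Ao; rewrite open_space_of => m.
by have /continuousP := hf m; apply.
Qed.

Lemma generated_final (I : topologicalType -> Prop) :
  (forall m, generated I (Z m)) -> generated I (space_of final).
Proof.
move=> gZ S So; rewrite open_space_of => m; apply: gZ => Y g IY gc.
rewrite -[_ @^-1` _]/((f m \o g) @^-1` S); apply: So => //.
by move=> y; apply: continuous_comp; [exact: gc|exact: continuous_final_leg].
Qed.

End Space.
End FinalTopology.

Lemma generated_self (I : topologicalType -> Prop) (Z : topologicalType) :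
  I Z -> generated I Z.
Proof. by move=> IZ S /(_ Z idfun IZ); apply => //; move=> x. Qed.

(** * Colimits of generated spaces *)

Section Colimit.
Variables (I : topologicalType -> Prop) (J : smallType) (D : category J).
Variable F : functor D (Top_generated I).

Definition diagram_point : smallType := {d : J & sval (F d)}.

Definition act (d d' : J) (a : hom D d d') : sval (F d) -> sval (F d') :=
  (fmap F a : continuousType (sval (F d)) (sval (F d'))).

Lemma act_comp (d d' d'' : J) (b : hom D d' d'') (a : hom D d d') y :
  act (comp b a) y = act b (act a y).
Proof. by rewrite /act fmap_comp. Qed.

Lemma act_continuous (d d' : J) (a : hom D d d') : continuous (act a).
Proof. exact: cts_fun. Qed.

Definition leg_fun c (k : cocone F c) (d : J) : sval (F d) -> sval c :=
  (leg k d : continuousType (sval (F d)) (sval c)).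
Arguments leg_fun {c} k d _.

Lemma leg_continuous c (k : cocone F c) d : continuous (leg_fun k d).
Proof. exact: cts_fun. Qed.

Lemma leg_act c (k : cocone F c) (d d' : J) (a : hom D d d') y :
  leg_fun k d' (act a y) = leg_fun k d y.
Proof.
exact: (congr1 (fun h : continuousType _ _ => h y) (leg_natural k a)).
Qed.

Definition respected (E : diagram_point -> diagram_point -> Prop) : Prop :=
  [/\ (forall x, E x x), (forall x y, E x y -> E y x),
      (forall x y z, E x y -> E y z -> E x z) &
      forall d d' (a : hom D d d') y,
        E (existT _ d y) (existT _ d' (act a y))].

(** The least equivalence relation on the disjoint union of the diagram that
    identifies each point with its images. *)
Definition glued (x y : diagram_point) : Prop := forall E, respected E -> E x y.

Lemma glued_respected : respected glued.
Proof.
split=> [x E []|x y xy E ER|x y z xy yz E ER|d d' a y E []] //.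
  by have [_ s _ _] := ER; exact: s (xy E ER).
by have [_ _ t _] := ER; exact: t (xy E ER) (yz E ER).
Qed.

(** The quotient of the disjoint union of the diagram by gluing, realised as
    the set of equivalence classes. *)
Definition glue_class : smallType := {A : set diagram_point | exists x, A = glued x}.

Definition to_class (x : diagram_point) : glue_class :=
  exist _ (glued x) (ex_intro _ x erefl).

Lemma to_class_eq x y : to_class x = to_class y <-> glued x y.
Proof.
have [r s t _] := glued_respected.
split=> [/(congr1 sval)/= ->|xy]; first exact: r.
apply: sval_inj => /=; apply/funext => z; apply/propext.
by split; apply: t => //; apply: s.
Qed.

Lemma to_class_surj (c : glue_class) : exists x, to_class x = c.
Proof. by case: c => A [x Ax]; exists x; apply: sval_inj. Qed.

Definition colim_space : topologicalType :=
  space_of (final (Z := fun d => sval (F d)) (fun d y => to_class (existT _ d y))).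

(** The colimit of topological spaces; it is generated because its topology is
    final for maps out of generated spaces. *)
Definition colim : {X | generated I X} :=
  exist (generated I) colim_space (@generated_final _ _ _ _ I (fun d => svalP (F d))).

Definition colim_leg (d : J) : continuousType (sval (F d)) colim_space :=
  cts (@continuous_final_leg _ (fun d => sval (F d)) _
         (fun d y => to_class (existT _ d y)) d).

Lemma colim_leg_natural (d d' : J) (a : hom D d d') :
  comp (c := Top_generated I) (Z := colim) (colim_leg d') (fmap F a) = colim_leg d.
Proof.
apply/continuousEP => y /=; apply/to_class_eq.
by have [_ s _ g] := glued_respected; apply: s; exact: g.
Qed.

Definition colim_cocone : cocone F colim := Cocone colim_leg_natural.

Lemma colim_is_colimit : is_colimit colim_cocone.
Proof.
move=> c' k'.
have [r rK] := choice to_class_surj.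
pose h (x : colim_space) : sval c' := leg_fun k' _ (projT2 (r x)).
have hE d y : h (to_class (existT _ d y)) = leg_fun k' d y.
  have /to_class_eq := rK (to_class (existT _ d y)).
  move=> /(_ (fun p q => leg_fun k' _ (projT2 p) = leg_fun k' _ (projT2 q))); apply.
  by split=> [|||d1 d2 a z] //= => [x y' z -> ->|] //; rewrite leg_act.
have hc : continuous h.
  apply: continuous_from_final => d.
  rewrite [X in continuous X](_ : _ = leg_fun k' d); first exact: leg_continuous.
  by apply/funext => y /=; rewrite hE.
exists (cts hc); split=> [d|h' h'E]; first by apply/continuousEP => y; exact: hE.
apply/continuousEP => x; have [[d y] <-] := to_class_surj x.
rewrite ctsE hE.
by rewrite /leg_fun -h'E.
Qed.

Section AnyColimit.
Variables (c : {X | generated I X}) (k : cocone F c).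
Hypothesis kcolim : is_colimit k.

(** Any colimit is isomorphic to the explicit one, hence inherits the
    description of its points, of their identifications and of its closed
    sets. *)
Lemma colimit_split : exists (h : sval c -> colim_space) (g : colim_space -> sval c),
  [/\ continuous h, continuous g, forall x, g (h x) = x,
      forall d y, h (leg_fun k d y) = to_class (existT _ d y) &
      forall d y, g (to_class (existT _ d y)) = leg_fun k d y].
Proof.
have [h [hE _]] := kcolim colim_cocone.
have [g [gE _]] := colim_is_colimit k.
have [u [_ uniq]] := kcolim k.
have hE' d y : (h : continuousType _ _) (leg_fun k d y) = to_class (existT _ d y).
  exact: (congr1 (fun f : continuousType _ _ => f y) (hE d)).
have gE' d y : (g : continuousType _ _) (to_class (existT _ d y)) = leg_fun k d y.
  exact: (congr1 (fun f : continuousType _ _ => f y) (gE d)).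
exists (h : continuousType _ _), (g : continuousType _ _); split => //.
- exact: cts_fun.
- exact: cts_fun.
have uE : u = comp (c := Top_generated I) g h.
  apply: uniq => d; apply/continuousEP => y.
  exact: etrans (congr1 (g : continuousType _ _) (hE' d y)) (gE' d y).
have u1 : u = idm (Top_generated I) c by apply: uniq => d; rewrite comp_idl.
move: u1; rewrite uE => gh x.
exact: (congr1 (fun f : continuousType _ _ => f x) gh).
Qed.

Lemma colimit_leg_surj (x : sval c) :
  exists p : diagram_point, leg_fun k _ (projT2 p) = x.
Proof.
have [h [g [_ _ gh _ gE]]] := colimit_split.
have [[d y] xE] := to_class_surj (h x).
by exists (existT _ d y) => /=; rewrite -gE xE gh.
Qed.

Lemma colimit_leg_glued (p q : diagram_point) :
  leg_fun k _ (projT2 p) = leg_fun k _ (projT2 q) -> glued p q.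
Proof.
case: p q => [d y] [d' y'] /= e.
have [h [g [_ _ _ hE _]]] := colimit_split.
by apply/to_class_eq; rewrite -!hE e.
Qed.

Lemma colimit_leg_closed (S : set (sval c)) :
  (forall d, closed (leg_fun k d @^-1` S)) -> closed S.
Proof.
move=> Sc; have [h [g [hc gc gh _ gE]]] := colimit_split.
have -> : S = h @^-1` (g @^-1` S) by apply/funext => x /=; rewrite gh.
apply: preimage_closed => //; rewrite -openC open_space_of => d.
rewrite preimage_setC openC.
rewrite [X in closed X](_ : _ = leg_fun k d @^-1` S); first exact: Sc.
by apply/funext => y /=; rewrite gE.
Qed.

End AnyColimit.
End Colimit.

Arguments leg_fun {I J D F c} k d _.

Lemma Top_generated_cocomplete I : cocomplete (Top_generated I).
Proof. by move=> J D F; exists (colim F), (colim_cocone F); exact: colim_is_colimit. Qed.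

(** * Cocones in filtered categories *)

Section Bipartite.
Variables (X Y E : smallType) (s : E -> X) (t : E -> Y).

(** The arrows of the category generated by a bipartite graph with edges E from
    X to Y are the identities, with code None, and the edges. *)
Definition bip_code (u v : X + Y) (e : option E) : Prop :=
  if e is Some e then u = inl (s e) /\ v = inr (t e) else u = v.

Definition bip_hom (u v : X + Y) : smallType := {e : option E | bip_code u v e}.

Lemma bip_id_proof u : bip_code u u None.
Proof. by []. Qed.

Lemma bip_comp_proof u v w (g : bip_hom v w) (f : bip_hom u v) :
  bip_code u w (if sval f is Some e then Some e else sval g).
Proof.
case: f g => [[e|] /= fE] [[e'|] /= gE]; subst => //.
by case: fE gE => _ -> [].
Qed.

Definition bip_idm u : bip_hom u u := exist _ None (bip_id_proof u).

Definition bip_comp u v w (g : bip_hom v w) (f : bip_hom u v) : bip_hom u w :=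
  exist _ _ (bip_comp_proof g f).

Lemma bip_comp_idl u v (f : bip_hom u v) : bip_comp (bip_idm v) f = f.
Proof. by apply: sval_inj => /=; case: (sval f). Qed.

Lemma bip_comp_idr u v (f : bip_hom u v) : bip_comp f (bip_idm u) = f.
Proof. exact: sval_inj. Qed.

Lemma bip_compA u v w x (h : bip_hom w x) (g : bip_hom v w) (f : bip_hom u v) :
  bip_comp h (bip_comp g f) = bip_comp (bip_comp h g) f.
Proof. by apply: sval_inj => /=; case: (sval f). Qed.

Definition bip : category (X + Y)%type :=
  Category bip_comp_idl bip_comp_idr bip_compA.

Lemma embeds_bip_arrow : embeds (arrow bip) (X + Y + E).
Proof.
exists (fun f => if sval (projT2 f) is Some e then inr e else inl (projT1 f).1).
move=> [[u v] [[e|] /= f]] [[u' v'] [[e'|] /= f']] //= [].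
- move: f' => /[swap] <- /[dup] -[-> ->] f'; case: f => -[??]; subst u v.
  by congr existT; apply: sval_inj.
- by move=> uu; subst => /=; congr existT; apply: sval_inj.
Qed.

Section Diagram.
Variables (J : smallType) (D : category J) (dX : X -> J) (dY : Y -> J).
Variable a : forall e, hom D (dX (s e)) (dY (t e)).

Definition bip_ob (u : X + Y) : J :=
  match u with inl x => dX x | inr y => dY y end.

Definition bip_map u v (f : bip_hom u v) : hom D (bip_ob u) (bip_ob v).
Proof.
case: f => -[e|] /=; first by case=> -> ->; exact: a.
by move=> ->; exact: idm.
Defined.

Lemma bip_map_id u : bip_map (bip_idm u) = idm D (bip_ob u).
Proof. by rewrite /bip_map /= (Prop_irrelevance (bip_id_proof u) erefl). Qed.

Lemma bip_map_comp u v w (g : bip_hom v w) (f : bip_hom u v) :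
  bip_map (bip_comp g f) = comp (bip_map g) (bip_map f).
Proof.
have [ef|[e fe]] : sval f = None \/ exists e, sval f = Some e.
- by case: (sval f) => [e|]; [right; exists e|left].
- have uv : u = v by case: f ef => -[].
  subst v; have -> : f = bip_idm u by exact: sval_inj.
  by rewrite bip_comp_idr bip_map_id comp_idr.
have vw : v = w.
  by case: f g fe => -[e'|] //= [_ ->] [[e''|] /=] // [].
subst w; have -> : g = bip_idm v.
  by apply: sval_inj; case: f g fe => -[e'|] //= [_ ->] [[e''|] /=] // [].
by rewrite bip_comp_idl bip_map_id comp_idl.
Qed.

Definition bip_functor : functor bip D :=
  @Functor _ _ bip D bip_ob bip_map bip_map_id bip_map_comp.

End Diagram.

(** The only shape of diagram needed from filteredness: bounding objects and
    coequalising parallel arrows are both instances of it. *)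
Lemma filtered_bipartite (K L J : smallType) (D : category J)
    (L_succ : forall T : Type, ~ embeds L T <-> embeds T K)
    (dX : X -> J) (dY : Y -> J) (a : forall e, hom D (dX (s e)) (dY (t e))) :
  filtered L D -> embeds (X + Y + E) K ->
  exists d (p : forall x, hom D (dX x) d) (q : forall y, hom D (dY y) d),
    forall e, comp (q (t e)) (a e) = p (s e).
Proof.
move=> Dfilt XYEK.
have [|d [k]] := Dfilt _ bip (bip_functor a).
  by apply/(card_lt_succT L_succ); apply: embeds_trans XYEK; exact: embeds_bip_arrow.
exists d, (fun x => leg k (inl x)), (fun y => leg k (inr y)) => e.
have ee : bip_code (inl (s e)) (inr (t e)) (Some e) by [].
rewrite -(leg_natural k (exist _ (Some e) ee : hom bip (inl (s e)) (inr (t e)))) /=.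
congr comp.
by rewrite (Prop_irrelevance ee (conj erefl erefl)).
Qed.

End Bipartite.

(** * Closure under size K *)

Section Bounded.
Variable K : smallType.
Hypotheses (KK : embeds (K * K) K) (natK : embeds nat K).

Lemma embeds_countType (T : countType) : embeds T K.
Proof.
by apply: embeds_trans (natK); exists pickle; exact: pcan_inj pickleK.
Qed.

Lemma embeds_prodK (T U : Type) : embeds T K -> embeds U K -> embeds (T * U) K.
Proof. by move=> TK UK; apply: embeds_trans (KK); exact: embeds_prod. Qed.

Lemma embeds_sigTK (T : Type) (U : T -> Type) :
  embeds T K -> (forall t, embeds (U t) K) -> embeds {t & U t} K.
Proof. by move=> TK UK; apply: embeds_trans (KK); exact: embeds_sigT. Qed.

Lemma embeds_sumK (T U : Type) : embeds T K -> embeds U K -> embeds (T + U) K.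
Proof.
move=> TK UK.
apply: embeds_trans (@embeds_sigTK bool (fun b => if b then T else U) _ _).
- exists (fun x => match x with inl t => existT (fun b => if b then T else U) true t
                          | inr u => existT (fun b => if b then T else U) false u end).
  by case=> [t|u] [t'|u'] // /(@existT_inj2 bool (fun b => if b then T else U)) ->.
- exact: embeds_countType.
- by case.
Qed.

Lemma embeds_sigK (T : Type) (A : set T) : embeds T K -> embeds {x | A x} K.
Proof. by apply: embeds_trans; exact: embeds_sig. Qed.

Lemma embeds_setK (T : Type) : embeds (T -> K) K -> embeds (set T) K.
Proof.
move=> TK; apply: embeds_trans (TK).
apply: embeds_trans (embeds_postcomp _ (embeds_countType bool)).
exists (fun A t => `[< A t >]) => A B /= AB; apply: funext => t.
have e : `[< A t >] = `[< B t >] by exact: (congr1 (fun k => k t) AB).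
by apply/propext; split=> /asboolP; [rewrite e|rewrite -e] => /asboolP.
Qed.

Lemma embeds_set0K (T : Type) : embeds {x : T | set0 x} K.
Proof. by exists (fun x => False_rect K (svalP x)); case. Qed.

Lemma embeds_bigcupK (P T : Type) (A : P -> set T) :
  embeds P K -> (forall p, embeds {x | A p x} K) ->
  embeds {x | exists p, A p x} K.
Proof.
move=> PK AK; apply: embeds_trans (embeds_sigTK PK AK).
apply: (@embeds_of_surj _ _ (fun q : {p & {x | A p x}} =>
  exist (fun x => exists p, A p x) (sval (projT2 q))
    (ex_intro _ (projT1 q) (svalP (projT2 q))))).
by case=> x [p px]; exists (existT _ p (exist _ x px)); exact: sval_inj.
Qed.

Lemma embeds_imageK (T U : Type) (f : T -> U) :
  embeds T K -> embeds {u | exists t, f t = u} K.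
Proof.
apply: embeds_trans.
apply: (@embeds_of_surj _ _ (fun t =>
  exist (fun u => exists t, f t = u) (f t) (ex_intro _ t erefl))).
by case=> u [t tu]; exists t; exact: sval_inj.
Qed.

Lemma embeds_setU1K (T : Type) (A : set T) (x : T) :
  embeds {y | A y} K -> embeds {y | y = x \/ A y} K.
Proof.
move=> AK; apply: embeds_trans (embeds_sumK (embeds_countType unit) AK).
apply: (@embeds_of_surj _ _ (fun q : unit + {y | A y} => match q with
  | inl _ => exist (fun y => y = x \/ A y) x (or_introl erefl)
  | inr y => exist (fun y => y = x \/ A y) (sval y) (or_intror (svalP y)) end)).
case=> y [yx|Ay]; first by exists (inl tt); apply: sval_inj.
by exists (inr (exist _ y Ay)); apply: sval_inj.
Qed.

(** * Continuity is witnessed by few charts *)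

Variables (Idx : smallType) (Z : Idx -> topologicalType).
Hypotheses (ZK : forall i, embeds (Z i) K) (ZexpK : forall i, embeds (Z i -> K) K).

(** The maps f m, the charts, have domains of bounded size and define a final
    topology on X, whose closed sets are those S with chart_closed setT S. *)
Section Charts.
Variables (M X : Type) (j : M -> Idx) (f : forall m, Z (j m) -> X).

Definition chart_closed (M' : set M) (S : set X) : Prop :=
  forall m, M' m -> closed (f (m := m) @^-1` S).

(** The sets closed for M' that contain A intersect in the closure of A for the
    charts in M'; few_closure A is the union of these closures over all sets M'
    of at most K charts. *)
Definition few_closure (A : set X) : set X :=
  [set x | exists M' : set M, embeds {m | M' m} K /\
     forall S, chart_closed M' S -> A `<=` S -> S x].

(** If z is adherent in the domain of a chart f m to points sent to few_closure
    A, the charts that force these images into the closure, together with f m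
    itself, force f m z into it. There are at most K of them because the domain
    of f m has at most K points. *)
Lemma few_closure_closed A : chart_closed setT (few_closure A).
Proof.
move=> m _ z zc.
have /choice[N NP] (a : {a | few_closure A (f (m := m) a)}) :
    exists M' : set M, embeds {m | M' m} K /\
      forall S, chart_closed M' S -> A `<=` S -> S (f (sval a)) by exact: svalP a.
exists [set m' | m' = m \/ exists a, N a m']; split.
  apply: embeds_setU1K; apply: embeds_bigcupK => [|a]; last by have [] := NP a.
  exact/embeds_sigK/ZK.
move=> S Sc AS; apply: (Sc m); first by left.
apply: closureS zc => a ga /=.
have [_ /(_ S)] := NP (exist _ a ga); apply => // m' am'; apply: Sc; right.
by exists (exist _ a ga).
Qed.

(** The continuity of g with respect to all charts amounts to the conditions
    that g z lies in the closure of g (A) whenever z is adherent to A. There are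
    at most K such pairs (A, z), and each condition is witnessed by at most K
    charts. *)
Lemma few_charts (i : Idx) (g : Z i -> X) :
  (forall S, chart_closed setT S -> closed (g @^-1` S)) ->
  exists M' : set M, embeds {m | M' m} K /\
    forall S, chart_closed M' S -> closed (g @^-1` S).
Proof.
move=> gc.
have /choice[N NP] (p : {p : set (Z i) * Z i | closure p.1 p.2}) :
    exists M' : set M, embeds {m | M' m} K /\
      forall S, chart_closed M' S -> g @` (sval p).1 `<=` S -> S (g (sval p).2).
  case: p => -[A z] /= Az.
  have := gc _ (@few_closure_closed (g @` A)); apply.
  apply: closureS Az => a Aa /=; exists set0; split; first exact: embeds_set0K.
  by move=> S _; apply; exists a.
exists [set m | exists p, N p m]; split.
  apply: embeds_bigcupK => [|p]; last by have [] := NP p.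
  by apply: embeds_sigK; apply: embeds_prodK => //; exact: embeds_setK.
move=> S Sc z zS; have [_ /(_ S)] := NP (exist _ (g @^-1` S, z) zS); apply.
  by move=> m pm; apply: Sc; exists (exist _ (g @^-1` S, z) zS).
by move=> _ [a aS <-].
Qed.

End Charts.
End Bounded.

(** * Small generated spaces are presentable *)

Section Main.
Variables (I : topologicalType -> Prop) (Idx : smallType) (Z : Idx -> topologicalType).
Hypothesis IZ : forall X, I X <-> exists i, Z i = X.

Lemma generated_closed (X : topologicalType) (S : set X) : generated I X ->
  (forall i (g : continuousType (Z i) X), closed (g @^-1` S)) -> closed S.
Proof.
move=> gX Sc; rewrite -openC; apply: gX => Y g /IZ[i iY] gc; subst Y.
by rewrite preimage_setC openC; exact: (Sc i (cts gc)).
Qed.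

Variables K L : smallType.
Hypotheses (KK : embeds (K * K) K) (natK : embeds nat K) (IdxK : embeds Idx K).
Hypotheses (ZK : forall i, embeds (Z i) K) (ZexpK : forall i, embeds (Z i -> K) K).
Hypothesis L_succ : forall T : Type, ~ embeds L T <-> embeds T K.

Section Filtered.
Variables (J : smallType) (D : category J).
Hypothesis Dfilt : filtered L D.
Variable F : functor D (Top_generated I).

Lemma act_idm d (y : sval (F d)) : act (idm D d) y = y.
Proof. by rewrite /act fmap_id. Qed.

(** In a filtered diagram, points are glued exactly when they become equal at
    some later stage. *)
Definition merged (p q : diagram_point F) : Prop :=
  exists e (a : hom D (projT1 p) e) (b : hom D (projT1 q) e),
    act a (projT2 p) = act b (projT2 q).

Lemma merged_respected : respected merged.
Proof.
split=> [x|x y [e [a [b ab]]]|x y z [e [a [b ab]]] [e' [b' [c bc]]]|d d' a y].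
- by exists (projT1 x), (idm _ _), (idm _ _).
- by exists e, b, a.
- have [||d [p [q pq]]] := @filtered_bipartite unit bool bool (fun=> tt) id
    K L J D L_succ (fun=> projT1 y) (fun i => if i then e else e')
    (fun i => match i with true => b | false => b' end).
  + exact: Dfilt.
  + exact: embeds_countType.
  have qb : comp (q true) b = comp (q false) b'.
    exact: etrans (pq true) (esym (pq false)).
  exists d, (comp (q true) a), (comp (q false) c).
  by rewrite !act_comp ab -bc -!act_comp qb.
- by exists d', a, (idm _ _); rewrite act_idm.
Qed.

Section ColimitCocone.
Variables (c : {X | generated I X}) (k : cocone F c).
Hypothesis kcolim : is_colimit k.

Lemma colimit_leg_merged (p q : diagram_point F) :
  leg_fun k _ (projT2 p) = leg_fun k _ (projT2 q) -> merged p q.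
Proof. move=> /(colimit_leg_glued kcolim); apply; exact: merged_respected. Qed.

(** At most K points of the diagram have at most K coincidences in the
    colimit, so a single stage realises all of them. *)
Lemma merge_few (X Q : smallType) (ob : X -> J) (ix : Q -> X)
    (pt : forall q, sval (F (ob (ix q)))) :
  embeds X K -> embeds Q K ->
  exists d (p : forall x, hom D (ob x) d), forall q q',
    leg_fun k _ (pt q) = leg_fun k _ (pt q') ->
    act (p (ix q)) (pt q) = act (p (ix q')) (pt q').
Proof.
move=> XK QK.
(* The coincidences; each is realised at some stage by a pair of arrows. *)
pose C : smallType := {qq : Q * Q | leg_fun k _ (pt qq.1) = leg_fun k _ (pt qq.2)}.
pose side (r : C) (b : bool) := if b then (sval r).1 else (sval r).2.
have /choice[e eP] (r : C) : exists e : J,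
    exists ab : hom D (ob (ix (side r true))) e * hom D (ob (ix (side r false))) e,
      act ab.1 (pt _) = act ab.2 (pt _).
  have [e [a [b ab]]] := @colimit_leg_merged
    (existT (fun d => sval (F d) : Type) _ (pt (sval r).1))
    (existT (fun d => sval (F d) : Type) _ (pt (sval r).2)) (svalP r).
  by exists e, (a, b).
have {eP} ab r := cid (eP r).
have [||d [p [q pq]]] := @filtered_bipartite X C (C * bool)
   (fun rb => ix (side rb.1 rb.2)) (fun rb => rb.1) K L J D L_succ ob e
   (fun rb => match rb.2 as b return hom D (ob (ix (side rb.1 b))) (e rb.1) with
     true => (sval (ab rb.1)).1 | false => (sval (ab rb.1)).2 end).
- exact: Dfilt.
- have CK : embeds C K by apply: embeds_sigK; exact: embeds_prodK.
  apply: embeds_sumK => //; first exact: embeds_sumK.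
  by apply: embeds_prodK => //; exact: embeds_countType.
exists d, p => x y xy; pose r : C := exist _ (x, y) xy.
rewrite -(pq (r, true)) -(pq (r, false)) /= !act_comp; congr act.
exact: svalP (ab r).
Qed.

Section Hom.
Variable Y : {X | generated I X}.
Hypothesis YK : embeds (sval Y) K.

Lemma embeds_continuousK i (X : topologicalType) :
  embeds X K -> embeds (continuousType (Z i) X) K.
Proof.
move=> XK; apply: embeds_trans (ZexpK i); apply: embeds_trans (embeds_postcomp _ XK).
exists (fun h : continuousType (Z i) X => h : Z i -> X) => h h' e.
by apply/continuousEP => z; rewrite e.
Qed.

(** A continuous map h from a small space Y into the colimit lifts to a stage
    as a function because Y has few points. For its continuity, the composites
    of h with the charts of Y are continuous because of a set N' of at most K
    charts of the colimit, all defined at stages of the diagram. At a stage d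
    where all coincidences among the points of Y and of the charts in N' are
    realised, the leg is injective on the images of these points; this turns a
    closed set of stage d into a set S' closed for the charts in N' with the
    same preimage. *)
Lemma colimit_lift (h : continuousType (sval Y) (sval c)) :
  exists d (u : continuousType (sval Y) (sval (F d))),
    forall y, leg_fun k d (u y) = h y.
Proof.
(* The charts of the stages, composed with the legs, define the topology of c. *)
pose M : smallType := {d : J & {i : Idx & continuousType (Z i) (sval (F d))}}.
pose ch (m : M) : continuousType (Z (projT1 (projT2 m))) (sval (F (projT1 m))) :=
  projT2 (projT2 m).
pose f (m : M) (z : Z (projT1 (projT2 m))) : sval c := leg_fun k _ (ch m z).
have fS S : chart_closed f setT S -> closed S.
  move=> Sc; apply: (colimit_leg_closed kcolim) => d.
  apply: (generated_closed (svalP (F d))) => i g.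
  exact: (Sc (existT _ d (existT _ i g)) Logic.I).
pose G : smallType := {i : Idx & continuousType (Z i) (sval Y)}.
have GK : embeds G K by apply: embeds_sigTK => // i; exact: embeds_continuousK.
have /choice[N NP] (g : G) : exists N : set M, embeds {m | N m} K /\
    forall S, chart_closed f N S -> closed ((h \o projT2 g) @^-1` S).
  apply: few_charts => // S /fS Sc.
  apply: preimage_closed => // x _; apply: continuous_comp; exact: cts_fun.
pose N' : smallType := {m | exists g, N g m}.
have N'K : embeds N' K by apply: embeds_bigcupK => // g; have [] := NP g.
have [P PE] := choice (fun y => colimit_leg_surj kcolim (h y)).
(* The points of Y and of the domains of the selected charts. *)
pose Q : smallType := (sval Y + {m : N' & Z (projT1 (projT2 (sval m)))})%type.
pose ix (q : Q) : (sval Y + N')%type :=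
  match q with inl y => inl y | inr mz => inr (projT1 mz) end.
pose ob (x : (sval Y + N')%type) : J :=
  match x with inl y => projT1 (P y) | inr m => projT1 (sval m) end.
pose pt (q : Q) : sval (F (ob (ix q))) :=
  match q return sval (F (ob (ix q))) with
    inl y => projT2 (P y) | inr mz => ch (sval (projT1 mz)) (projT2 mz) end.
have [||d [p pE]] := merge_few (ix := ix) pt.
- exact: embeds_sumK.
- by apply: embeds_sumK => //; exact: embeds_sigTK.
pose im q := act (p (ix q)) (pt q).
have imE q : leg_fun k d (im q) = leg_fun k _ (pt q) by exact: leg_act.
pose u (y : sval Y) : sval (F d) := im (inl y).
have uE y : leg_fun k d (u y) = h y by rewrite imE /= PE.
suff uc : continuous u by exists d, (cts uc).
apply/continuous_closedP => S Sc.
apply: (generated_closed (svalP Y)) => i g.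
(* The image under the leg of the part of S made of images of points in Q. *)
pose S' : set (sval c) := [set x | exists2 q, S (im q) & leg_fun k _ (pt q) = x].
have S'E q : S' (leg_fun k _ (pt q)) = S (im q).
  by apply/propext; split=> [[q' Sq' /pE]|Sq]; [rewrite /im => <-|exists q].
have [_ /(_ S')] := NP (existT _ i g).
rewrite [X in (_ -> closed X) -> _](_ : _ = g @^-1` (u @^-1` S)); last first.
  by apply/funext => z /=; rewrite -PE -[RHS]S'E.
apply=> m Nm; pose m' : N' := exist _ m (ex_intro _ _ Nm).
rewrite [X in closed X](_ : _ = (act (p (inr m')) \o ch m) @^-1` S).
  apply: preimage_closed => // z _; apply: continuous_comp; first exact: cts_fun.
  exact: act_continuous.
by apply/funext => z; exact: (S'E (inr (existT _ m' z))).
Qed.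

(** The two lifts give one coincidence for each point of Y, hence at most K. *)
Lemma colimit_lift_unique d d' (u : continuousType (sval Y) (sval (F d)))
    (u' : continuousType (sval Y) (sval (F d'))) :
  (forall y, leg_fun k d (u y) = leg_fun k d' (u' y)) ->
  exists e (a : hom D d e) (b : hom D d' e), forall y, act a (u y) = act b (u' y).
Proof.
move=> uu'.
have [||e [p pE]] := @merge_few bool (sval Y * bool)%type (fun b => if b then d else d')
  snd (fun q => match q.2 as b return sval (F (if b then d else d')) with
                  true => u q.1 | false => u' q.1 end).
- exact: embeds_countType.
- by apply: embeds_prodK => //; exact: embeds_countType.
exists e, (p true), (p false) => y.
exact: (pE (y, true) (y, false) (uu' y)).
Qed.

End Hom.
End ColimitCocone.
End Filtered.

Theorem small_presentable (Y : {X | generated I X}) :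
  embeds (sval Y) K -> presentable L (Top_generated I) Y.
Proof.
move=> YK J D Dfilt F c k kcolim X k'.
have natural d e (a : hom D d e) (u : continuousType (sval Y) (sval (F d))) :
    leg k' e (comp (c := Top_generated I) (fmap F a) u) = leg k' d u.
  exact: (congr1 (fun f => f u) (leg_natural k' a)).
pose lift (h : continuousType (sval Y) (sval c))
    (w : {d : J & continuousType (sval Y) (sval (F d))}) : Prop :=
  forall y, leg_fun k _ (projT2 w y) = h y.
have /choice[H HE] (h : continuousType (sval Y) (sval c)) :
    exists x : X, forall w, lift h w -> leg k' _ (projT2 w) = x.
  have [d [u uE]] := colimit_lift Dfilt kcolim YK h.
  exists (leg k' d u) => -[d' u'] /= u'E.
  have [|e [a [b ab]]] := colimit_lift_unique Dfilt kcolim YK (u := u) (u' := u').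
    by move=> y; rewrite uE u'E.
  rewrite -(natural _ _ a) -(natural _ _ b); congr (leg k' e _).
  by apply/continuousEP => y; exact/esym/ab.
exists H; split=> [d|H' H'E].
  by apply: funext => u; apply/esym; exact: (HE _ (existT _ d u)).
apply: funext => h; have [d [u uE]] := colimit_lift Dfilt kcolim YK h.
rewrite -(HE h (existT _ d u) uE) -H'E /=; congr H'.
by apply/continuousEP => y; exact: uE.
Qed.

(** * Generated spaces as directed colimits of small ones *)

(** The generated spaces carried by subsets of K form a small family, and up to
    isomorphism they are all the generated spaces of size at most K. *)
Definition small_code : smallType :=
  {B : set K & {t : topology {k | B k} | generated I (space_of t)}}.

Definition small_space (s : small_code) : {X | generated I X} :=
  exist (generated I) (space_of (sval (projT2 s))) (svalP (projT2 s)).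

Section Approximation.
Variable X : {X | generated I X}.

Definition chart : smallType := {i : Idx & continuousType (Z i) (sval X)}.

(** A piece of X is a small set of points with a small set of charts of X that
    land in it. Its topology will be the final one for these charts, in general
    finer than the topology induced by X. *)
Definition piece_spec (p : set (sval X) * set chart) : Prop :=
  [/\ embeds {x | p.1 x} K, embeds {m | p.2 m} K &
      forall m z, p.2 m -> p.1 (projT2 m z)].

Definition piece : smallType := {p | piece_spec p}.

Definition pts (p : piece) : set (sval X) := (sval p).1.
Definition charts (p : piece) : set chart := (sval p).2.

Lemma small_copy (p : piece) : exists (B : set K) (i : {k | B k} -> sval X),
  injective i /\ forall x, pts p x <-> exists k, i k = x.
Proof.
have [[f fI] _ _] := svalP p.
exists [set k | exists x, f x = k].
exists (fun k : {k | exists x, f x = k} => sval (sval (cid (svalP k)))).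
split=> [k k' /sval_inj kk'|x].
  apply: sval_inj; move: kk'; case: (cid (svalP k)) => x /= <-.
  by case: (cid (svalP k')) => x' /= <- ->.
split=> [px|[k <-]]; last exact: svalP.
exists (exist _ (f (exist _ x px)) (ex_intro _ _ erefl)).
by case: cid => y /= /fI ->.
Qed.

Definition code (p : piece) : set K := sval (cid (small_copy p)).

(** The points of a piece are renamed by elements of K, so that the space of
    the piece literally belongs to the small family. *)
Definition incl (p : piece) : {k | code p k} -> sval X :=
  sval (cid (svalP (cid (small_copy p)))).

Lemma incl_inj p : injective (@incl p).
Proof. by have [] := svalP (cid (svalP (cid (small_copy p)))). Qed.

Lemma pts_incl p x : pts p x <-> exists k, @incl p k = x.
Proof. by have [_] := svalP (cid (svalP (cid (small_copy p)))). Qed.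

Lemma chart_in_ex p (m : {m | charts p m}) (z : Z (projT1 (sval m))) :
  exists k, @incl p k = projT2 (sval m) z.
Proof. by apply/pts_incl; have [_ _] := svalP p; apply; exact: svalP. Qed.

Definition chart_in p m z := sval (cid (@chart_in_ex p m z)).

Lemma incl_chart_in p m z : incl (@chart_in p m z) = projT2 (sval m) z.
Proof. exact: svalP (cid (@chart_in_ex p m z)). Qed.

Definition piece_topology p : topology {k | code p k} := final (@chart_in p).

Lemma generated_piece p : generated I (space_of (piece_topology p)).
Proof. by apply: generated_final => m; apply/generated_self/IZ; eexists. Qed.

Definition piece_code (p : piece) : small_code :=
  existT _ (code p) (exist _ (piece_topology p) (@generated_piece p)).

Definition piece_space (p : piece) : {X | generated I X} := small_space (piece_code p).

Lemma chart_in_continuous p m :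
  continuous (@chart_in p m : Z (projT1 (sval m)) -> sval (piece_space p)).
Proof.
exact: (@continuous_final_leg _ (fun m : {m | charts p m} => Z (projT1 (sval m))) _
  (@chart_in p)).
Qed.

Lemma incl_continuous p : continuous (@incl p : sval (piece_space p) -> sval X).
Proof.
apply: continuous_from_final => m.
rewrite [X in continuous X](_ : _ = (projT2 (sval m) : _ -> _)); first exact: cts_fun.
by apply/funext => z; exact: incl_chart_in.
Qed.

Definition piece_le : rel piece :=
  fun p q => `[< pts p `<=` pts q /\ charts p `<=` charts q >].

Lemma piece_le_poset : is_poset piece_le.
Proof.
split=> [p|p q /andP[/asboolP[pq pq'] /asboolP[qp qp']]|
         q p r /asboolP[pq pq'] /asboolP[qr qr']].
- by apply/asboolP; split.
- apply: sval_inj; move: pq pq' qp qp'; rewrite /pts /charts.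
  case: (sval p) (sval q) => [A B] [A' B'] /= *.
  by congr pair; apply/seteqP.
- by apply/asboolP; split; [move=> x /pq/qr|move=> x /pq'/qr'].
Qed.

Lemma piece_map_ex p q (pq : piece_le p q) (k : {k | code p k}) :
  exists k' : {k | code q k}, incl k' = incl k.
Proof.
by apply/pts_incl; have /asboolP[h _] := pq; apply/h/pts_incl; exists k.
Qed.

Definition piece_map_fun p q pq k := sval (cid (@piece_map_ex p q pq k)).

Lemma incl_piece_map p q pq k : incl (@piece_map_fun p q pq k) = incl k.
Proof. exact: svalP (cid (@piece_map_ex p q pq k)). Qed.

Lemma piece_map_continuous p q (pq : piece_le p q) :
  continuous (piece_map_fun pq : sval (piece_space p) -> sval (piece_space q)).
Proof.
apply: continuous_from_final => m.
have /asboolP[_ h] := pq.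
pose m' : {m | charts q m} := exist _ (sval m) (h _ (svalP m)).
rewrite [X in continuous X](_ : _ = @chart_in q m').
  exact: (@chart_in_continuous q m').
apply/funext => z; apply: incl_inj.
by rewrite [LHS]incl_piece_map incl_chart_in [RHS]incl_chart_in.
Qed.

Definition piece_map p q (pq : piece_le p q) :
    hom (Top_generated I) (piece_space p) (piece_space q) :=
  cts (@piece_map_continuous _ _ pq).

Lemma piece_map_id p :
  piece_map (poset_refl piece_le_poset p) = idm (Top_generated I) (piece_space p).
Proof. by apply/continuousEP => k; apply: incl_inj; exact: incl_piece_map. Qed.

Lemma piece_map_comp p q r (qr : piece_le q r) (pq : piece_le p q) :
  piece_map (poset_trans piece_le_poset qr pq) =
  comp (c := Top_generated I) (piece_map qr) (piece_map pq).
Proof.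
apply/continuousEP => k; apply: incl_inj.
by rewrite [LHS]incl_piece_map [RHS]incl_piece_map [RHS]incl_piece_map.
Qed.

Definition pieces : functor (poset_category piece_le_poset) (Top_generated I) :=
  @Functor _ _ (poset_category piece_le_poset) (Top_generated I) piece_space
    piece_map piece_map_id piece_map_comp.

Definition piece_leg p : hom (Top_generated I) (piece_space p) X :=
  cts (@incl_continuous p).

Lemma piece_leg_natural p q (pq : piece_le p q) :
  comp (c := Top_generated I) (piece_leg q) (piece_map pq) = piece_leg p.
Proof. by apply/continuousEP => k; exact: incl_piece_map. Qed.

Definition pieces_cocone : cocone pieces X :=
  @Cocone _ _ (Top_generated I) (poset_category piece_le_poset) pieces X
    piece_leg piece_leg_natural.

(** One-point pieces make the pieces cover X, even where X has no chart. *)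
Lemma point_piece_spec x : piece_spec ([set y | exists t : unit, x = y], set0).
Proof.
split=> //=; last exact: embeds_set0K.
by apply: embeds_imageK; exact: embeds_countType.
Qed.

(** The pieces given by a single chart make every chart of X factor through
    some piece, hence the topology of X is the colimit topology. *)
Lemma chart_piece_spec (m : chart) :
  piece_spec ([set y | exists z, projT2 m z = y], [set m' | m' = m \/ set0 m']).
Proof.
split=> /=; first by exact: embeds_imageK.
  by apply: embeds_setU1K => //; exact: embeds_set0K.
by move=> m' z [m'm|//]; subst m'; exists z.
Qed.

Lemma pieces_colimit : is_colimit pieces_cocone.
Proof.
move=> c' k'.
pose l p : sval (piece_space p) -> sval c' := (leg k' p : continuousType _ _).
have lE p q (pq : piece_le p q) k : l q (piece_map_fun pq k) = l p k.
  have e := leg_natural k' (pq : hom (poset_category piece_le_poset) p q).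
  exact: (congr1 (fun h : continuousType (sval (piece_space p)) (sval c') => h k) e).
pose P0 x : piece := exist _ _ (point_piece_spec x).
have rP x : exists k : {k | code (P0 x) k}, incl k = x.
  by apply/pts_incl; exists tt.
pose r x := sval (cid (rP x)); have rE x : incl (r x) = x by exact: svalP (cid (rP x)).
pose h x := l _ (r x).
have hE p (k : {k | code p k}) : h (incl k) = l p k.
  have pq : piece_le (P0 (incl k)) p.
    by apply/asboolP; split=> // y [_ <-]; apply/pts_incl; exists k.
  rewrite /h -(lE _ _ pq); congr (l p _); apply: incl_inj.
  by rewrite incl_piece_map rE.
have hc : continuous h.
  apply/continuous_closedP => S Sc.
  apply: (generated_closed (svalP X)) => i g.
  pose p : piece := exist _ _ (chart_piece_spec (existT _ i g)).
  pose m : {m | charts p m} := exist _ (existT _ i g) (or_introl erefl).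
  rewrite [X in closed X](_ : _ = @chart_in p m @^-1` (l p @^-1` S)).
    apply: (@preimage_closed _ (sval (piece_space p))) => [z _|].
      exact: (@chart_in_continuous p m).
    by apply: preimage_closed => // z _; exact: cts_fun.
  by apply/funext => z; rewrite /preimage /= -hE incl_chart_in.
exists (cts hc); split=> [p|h' h'E]; first by apply/continuousEP => k; exact: hE.
apply/continuousEP => x; rewrite ctsE /h.
rewrite -[x in RHS]rE.
have e := h'E (P0 x).
exact: (congr1 (fun h : continuousType (sval (piece_space (P0 x))) (sval c') =>
  h (r x)) (esym e)).
Qed.

(** The union of at most K pieces is a piece. *)
Lemma directed_pieces : directed L piece_le.
Proof.
move=> A /(card_lt_succ L_succ) AK.
have uP : piece_spec ([set x | exists a : {a | A a}, pts (sval a) x],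
                      [set m | exists a : {a | A a}, charts (sval a) m]).
  split=> /=.
  - by apply: embeds_bigcupK => // -[[a []]].
  - by apply: embeds_bigcupK => // -[[a []]].
  - by move=> m z [a am]; exists a; have [_ _] := svalP (sval a); apply.
exists (exist _ _ uP) => a Aa; apply/asboolP.
by split=> [x ax|m am]; exists (exist _ a Aa).
Qed.

End Approximation.

Theorem Top_generated_presentable : locally_presentable (Top_generated I).
Proof.
exists L; split.
- exact: succ_regular L_succ natK KK.
- exact: Top_generated_cocomplete.
- exists (fun Y => exists s, small_space s = Y); split.
  + by exists small_code, small_space.
  + by move=> Y [s <-]; apply: small_presentable; exact: embeds_sig.
  + move=> X; exists (piece X), (@piece_le X), (@piece_le_poset X).
    exists (@pieces X), (@pieces_cocone X).
    split; [exact: directed_pieces| |exact: pieces_colimit].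
    by move=> p; exists (piece_code p).
Qed.

End Main.

Theorem corollary3p7 (I : topologicalType -> Prop) (I_small : small_class I) :
  locally_presentable (Top_generated I).
Proof.
have [Idx [Z IZ]] := I_small.
have [K [KK natK IdxK ZK ZexpK]] := bounding_cardinal (fun i => Z i : Type).
have [L L_succ] := successor_cardinal K.
exact (Top_generated_presentable IZ KK natK IdxK ZK ZexpK L_succ).
Qed.
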